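(* Let $q\in\mathbb{C}\setminus\{0\}$ be not a root of unity, let $\mathcal{A}_q=\mathcal{A}_q(x,\xi,\theta,z)$ be the algebra of polynomials on the double-graded quantum superplane, and let $\partial_x,\partial_\xi,\partial_\theta,\partial_z:\mathcal{A}_q\to\mathcal{A}_q$ be the partial derivatives described in the context. The commutation rules between the partial derivatives are: $$\partial_x\partial_\xi=q\,\partial_\xi\partial_x,\quad \partial_x\partial_\theta=q\,\partial_\theta\partial_x,\quad \partial_x\partial_z=\partial_z\partial_x,\quad \partial_\xi\partial_\theta=\partial_\theta\partial_\xi,$$ $$\partial_\xi\partial_z=-q^{-1}\partial_z\partial_\xi,\quad \partial_\theta\partial_z=-q^{-1}\partial_z\partial_\theta,\quad \partial_\xi\partial_\xi=0,\quad \partial_\theta\partial_\theta=0.$$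
   Context: The base field is $\mathbb{C}$. $\mathcal{A}_q=\mathcal{A}_q(x,\xi,\theta,z)$ is the $\mathbb{Z}_2\times\mathbb{Z}_2$-graded, associative, unital algebra generated by $x,\xi,\theta,z$ of degrees $(0,0),(0,1),(1,0),(1,1)$ respectively, subject to the relations $$x\xi=q\,\xi x,\quad x\theta=q\,\theta x,\quad xz=zx,\quad \xi^2=0,\quad \theta^2=0,\quad \xi\theta=\theta\xi,\quad \xi z=-q^{-1}z\xi,\quad \theta z=-q^{-1}z\theta.$$ It has the PBW-like basis $x^m\xi^\alpha\theta^\beta z^n$ with $m,n\in\mathbb{N}$ (including $0$) and $\alpha,\beta\in\{0,1\}$. The partial derivatives are the linear maps $\partial_x,\partial_\xi,\partial_\theta,\partial_z:\mathcal{A}_q\to\mathcal{A}_q$ given by $\mathrm{d}f=\mathrm{d}x\,\partial_xf+\mathrm{d}\xi\,\partial_\xi f+\mathrm{d}\theta\,\partial_\theta f+\mathrm{d}z\,\partial_zf$, where $\mathrm{d}$ is the differential of the calculus whose one-forms have basis $\mathrm{d}x,\mathrm{d}\xi,\mathrm{d}\theta,\mathrm{d}z$ and which satisfies the Leibniz rule $\mathrm{d}(fg)=(\mathrm{d}f)g+f\,\mathrm{d}g$ and the commutation rules $$x\,\mathrm{d}x=\mathrm{d}x\,x,\quad x\,\mathrm{d}\xi=q\,\mathrm{d}\xi\,x,\quad x\,\mathrm{d}\theta=q\,\mathrm{d}\theta\,x,\quad x\,\mathrm{d}z=\mathrm{d}z\,x,$$ $$\xi\,\mathrm{d}x=q^{-1}\mathrm{d}x\,\xi,\quad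 \xi\,\mathrm{d}\xi=-\mathrm{d}\xi\,\xi,\quad \xi\,\mathrm{d}\theta=\mathrm{d}\theta\,\xi,\quad \xi\,\mathrm{d}z=-q^{-1}\mathrm{d}z\,\xi,$$ $$\theta\,\mathrm{d}x=q^{-1}\mathrm{d}x\,\theta,\quad \theta\,\mathrm{d}\xi=\mathrm{d}\xi\,\theta,\quad \theta\,\mathrm{d}\theta=-\mathrm{d}\theta\,\theta,\quad \theta\,\mathrm{d}z=-q^{-1}\mathrm{d}z\,\theta,$$ $$z\,\mathrm{d}x=\mathrm{d}x\,z,\quad z\,\mathrm{d}\xi=-q\,\mathrm{d}\xi\,z,\quad z\,\mathrm{d}\theta=-q\,\mathrm{d}\theta\,z,\quad z\,\mathrm{d}z=\mathrm{d}z\,z.$$ Equivalently, they are the linear maps that vanish on $1$ and satisfy, as operators on $\mathcal{A}_q$ (coordinates acting by left multiplication), $$\partial_x x=1+x\partial_x,\quad \partial_\xi x=q\,x\partial_\xi,\quad \partial_\theta x=q\,x\partial_\theta,\quad \partial_z x=x\partial_z,$$ $$\partial_x\xi=q^{-1}\xi\partial_x,\quad \partial_\xi\xi=1-\xi\partial_\xi,\quad \partial_\theta\xi=\xi\partial_\theta,\quad \partial_z\xi=-q^{-1}\xi\partial_z,$$ $$\partial_x\theta=q^{-1}\theta\partial_x,\quad \partial_\xi\theta=\theta\partial_\xi,\quad \partial_\theta\theta=1-\theta\partial_\theta,\quad \partial_z\theta=-q^{-1}\theta\partial_z,$$ $$\partial_x z=z\partial_x,\quad \partial_\xi z=-q\,z\partial_\xi,\quad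 \partial_\theta z=-q\,z\partial_\theta,\quad \partial_z z=1+z\partial_z.$$ *)

(* Defs.v *)
From HB Require Import structures.
From mathcomp Require Import all_boot all_algebra.
From mathcomp Require Import boolp reals complex.
From mathcomp.multinomials Require Import monalg.

Set Implicit Arguments.
Unset Strict Implicit.
Unset Printing Implicit Defensive.

Import GRing.Theory.
Local Open Scope ring_scope.
Local Open Scope quotient_scope.

(* The four generators have pairwise distinct degrees exhausting Z_2 x Z_2,
   so each generator is named by its degree. *)
Definition gen : Type := (bool * bool)%type.
Definition gx : gen := (false, false).
Definition gxi : gen := (false, true).
Definition gtheta : gen := (true, false).
Definition gz : gen := (true, true).

Section SuperplaneAlgebra.
Variables (K : fieldType) (q : K).

(* The free associative unital K-algebra on the generators: the monoid algebra
   of the free monoid of words in them. *)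
Local Notation Free := {malg K[{fmonom gen}]}.

Definition free_gen (g : gen) : Free := mkmalgU (fmu g) 1.

Local Notation x := (free_gen gx).
Local Notation xi := (free_gen gxi).
Local Notation theta := (free_gen gtheta).
Local Notation z := (free_gen gz).

Definition superplane_relations : seq Free :=
  [:: x * xi - q *: (xi * x);
      x * theta - q *: (theta * x);
      x * z - z * x;
      xi * xi;
      theta * theta;
      xi * theta - theta * xi;
      xi * z + q^-1 *: (z * xi);
      theta * z + q^-1 *: (z * theta)].

(* The two-sided ideal generated by the relations. *)
Inductive in_superplane_ideal : Free -> Prop :=
| SuperplaneIdeal0 : in_superplane_ideal 0
| SuperplaneIdealD a r b p of r \in superplane_relations
    & in_superplane_ideal p : in_superplane_ideal (a * r * b + p).

Definition superplane_ideal : {pred Free} := fun p => `[< in_superplane_ideal p >].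

Lemma superplane_idealP p :
  reflect (in_superplane_ideal p) (p \in superplane_ideal).
Proof. exact: asboolP. Qed.

Lemma superplane_idealD p p' : p \in superplane_ideal ->
  p' \in superplane_ideal -> p + p' \in superplane_ideal.
Proof.
move=> /superplane_idealP Ip /superplane_idealP Ip'; apply/superplane_idealP.
elim: Ip => [|a r b s rr _ IH]; first by rewrite add0r.
by rewrite -addrA; constructor.
Qed.

Lemma superplane_idealMl c p :
  p \in superplane_ideal -> c * p \in superplane_ideal.
Proof.
move=> /superplane_idealP Ip; apply/superplane_idealP.
elim: Ip => [|a r b s rr _ IH]; first by rewrite mulr0; constructor.
by rewrite mulrDr !mulrA; constructor.
Qed.

Lemma superplane_idealMr c p :
  p \in superplane_ideal -> p * c \in superplane_ideal.
Proof.
move=> /superplane_idealP Ip; apply/superplane_idealP.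
elim: Ip => [|a r b s rr _ IH]; first by rewrite mul0r; constructor.
by rewrite mulrDl -!mulrA [a * _]mulrA; constructor.
Qed.

Lemma superplane_ideal_zmod_closed : zmod_closed superplane_ideal.
Proof.
split=> [|p p' Ip Ip']; first by apply/superplane_idealP; constructor.
by apply: superplane_idealD => //; rewrite -mulN1r superplane_idealMl.
Qed.
HB.instance Definition _ :=
  GRing.isZmodClosed.Build Free superplane_ideal superplane_ideal_zmod_closed.

Lemma superplane_relation_in r :
  r \in superplane_relations -> r \in superplane_ideal.
Proof.
move=> rr; apply/superplane_idealP.
have -> : r = 1 * r * 1 + 0 by rewrite mul1r mulr1 addr0.
by apply: SuperplaneIdealD rr _; constructor.
Qed.

Lemma superplane_ideal_coef1 p : p \in superplane_ideal -> p@_mone = 0.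
Proof.
have gM g h : (free_gen g * free_gen h)@_mone = 0 :> K.
  by rewrite rmorphM /= mcoeffU fmP fm1 fmuE mul0r.
have gZ c (s : Free) : s@_mone = 0 -> (c *: s)@_mone = 0.
  by move=> s0; rewrite mcoeffZ s0 mulr0.
have gB (s t : Free) : s@_mone = 0 -> t@_mone = 0 -> (s - t)@_mone = 0.
  by move=> s0 t0; rewrite mcoeffB s0 t0 subr0.
have gD (s t : Free) : s@_mone = 0 -> t@_mone = 0 -> (s + t)@_mone = 0.
  by move=> s0 t0; rewrite mcoeffD s0 t0 addr0.
move=> /superplane_idealP; elim=> [|a r b s rr _ IH]; first by rewrite mcoeff0.
apply: (gD) => //; rewrite !rmorphM /=.
suff -> : r@_mone = 0 :> K by rewrite mulr0 mul0r.
move: rr; rewrite /superplane_relations !in_cons in_nil.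
case/orP=> [/eqP->|]; first by apply: gB (gM _ _) (gZ _ _ (gM _ _)).
case/orP=> [/eqP->|]; first by apply: gB (gM _ _) (gZ _ _ (gM _ _)).
case/orP=> [/eqP->|]; first by apply: gB (gM _ _) (gM _ _).
case/orP=> [/eqP->|]; first exact: gM.
case/orP=> [/eqP->|]; first exact: gM.
case/orP=> [/eqP->|]; first by apply: gB (gM _ _) (gM _ _).
case/orP=> [/eqP->|]; first by apply: gD (gM _ _) (gZ _ _ (gM _ _)).
by case/orP=> [/eqP->|//]; apply: gD (gM _ _) (gZ _ _ (gM _ _)).
Qed.

Lemma superplane_ideal1 : 1 \notin superplane_ideal.
Proof.
apply/negP => /superplane_ideal_coef1; rewrite rmorph1.
by apply/eqP; rewrite oner_eq0.
Qed.

(* The free algebra modulo the ideal of relations.  The additive quotient comes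
   from the library; its ring quotients require a commutative ring, hence the
   product and the scaling below. *)
Definition Aq : Type := Quotient.quot superplane_ideal.
HB.instance Definition _ := Choice.on Aq.
HB.instance Definition _ := GRing.Zmodule.on Aq.
HB.instance Definition _ := EqQuotient.on Aq.

Definition to_Aq (p : Free) : Aq := \pi_Aq p.

Lemma to_AqP p p' : to_Aq p = to_Aq p' <-> p - p' \in superplane_ideal.
Proof. by rewrite Quotient.idealrBE; split=> [pp|/eqP//]; apply/eqP. Qed.

Lemma to_Aq_repr (a : Aq) : to_Aq (repr a) = a.
Proof. exact: reprK. Qed.

Lemma to_AqB : zmod_morphism to_Aq.
Proof. by move=> p p'; rewrite /to_Aq !piE. Qed.
HB.instance Definition _ := GRing.isZmodMorphism.Build Free Aq to_Aq to_AqB.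

Definition Aq_one : Aq := to_Aq 1.
Definition Aq_mul (a b : Aq) : Aq := to_Aq (repr a * repr b).
Definition Aq_scale (c : K) (a : Aq) : Aq := to_Aq (c *: repr a).

Lemma to_AqM p p' : to_Aq (p * p') = Aq_mul (to_Aq p) (to_Aq p').
Proof.
have Ir r : r - repr (to_Aq r) \in superplane_ideal.
  by apply/to_AqP; rewrite to_Aq_repr.
have E (s s' : Free) : p * p' - s * s' = (p - s) * p' + s * (p' - s').
  by rewrite mulrBl mulrBr addrA subrK.
apply/to_AqP; rewrite E.
exact: superplane_idealD (superplane_idealMr _ (Ir p))
  (superplane_idealMl _ (Ir p')).
Qed.

Lemma to_AqZ c p : to_Aq (c *: p) = Aq_scale c (to_Aq p).
Proof.
apply/to_AqP; rewrite -scalerBr -mul_malgC superplane_idealMl //.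
by apply/to_AqP; rewrite to_Aq_repr.
Qed.

Lemma Aq_ind (P : Aq -> Prop) : (forall p, P (to_Aq p)) -> forall a, P a.
Proof. by move=> PP a; rewrite -[a]to_Aq_repr. Qed.

Lemma Aq_mulA : associative Aq_mul.
Proof. by do 3!elim/Aq_ind=> ?; rewrite -!to_AqM mulrA. Qed.
Lemma Aq_mul1 : left_id Aq_one Aq_mul.
Proof. by elim/Aq_ind=> ?; rewrite -!to_AqM mul1r. Qed.
Lemma Aq_mulr1 : right_id Aq_one Aq_mul.
Proof. by elim/Aq_ind=> ?; rewrite -!to_AqM mulr1. Qed.
Lemma Aq_mulDl : left_distributive Aq_mul +%R.
Proof. by do 3!elim/Aq_ind=> ?; rewrite -raddfD -!to_AqM mulrDl raddfD. Qed.
Lemma Aq_mulDr : right_distributive Aq_mul +%R.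
Proof. by do 3!elim/Aq_ind=> ?; rewrite -raddfD -!to_AqM mulrDr raddfD. Qed.
Lemma Aq_one_neq0 : Aq_one != 0.
Proof.
apply/eqP; rewrite -[RHS](raddf0 to_Aq) => /to_AqP.
by rewrite subr0 (negPf superplane_ideal1).
Qed.
HB.instance Definition _ := GRing.Zmodule_isNzRing.Build Aq
  Aq_mulA Aq_mul1 Aq_mulr1 Aq_mulDl Aq_mulDr Aq_one_neq0.

Lemma Aq_scaleA a b v : Aq_scale a (Aq_scale b v) = Aq_scale (a * b) v.
Proof. by elim/Aq_ind: v => ?; rewrite -!to_AqZ scalerA. Qed.
Lemma Aq_scale1 : left_id 1 Aq_scale.
Proof. by elim/Aq_ind=> ?; rewrite -to_AqZ scale1r. Qed.
Lemma Aq_scaleDr : right_distributive Aq_scale +%R.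
Proof.
by move=> ?; do 2!elim/Aq_ind=> ?; rewrite -raddfD -!to_AqZ scalerDr raddfD.
Qed.
Lemma Aq_scaleDl v : {morph Aq_scale^~ v : a b / a + b}.
Proof. by elim/Aq_ind: v => ? ? ?; rewrite -!to_AqZ scalerDl raddfD. Qed.
HB.instance Definition _ := GRing.Zmodule_isLmodule.Build K Aq
  Aq_scaleA Aq_scale1 Aq_scaleDr Aq_scaleDl.

Lemma Aq_scaleAl c (a b : Aq) : c *: (a * b) = c *: a * b.
Proof.
elim/Aq_ind: a => p; elim/Aq_ind: b => p'.
transitivity (to_Aq (c *: (p * p'))); first by rewrite to_AqZ to_AqM.
by rewrite scalerAl to_AqM to_AqZ.
Qed.
HB.instance Definition _ := GRing.Lmodule_isLalgebra.Build K Aq Aq_scaleAl.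

Lemma free_scaleAr c (p p' : Free) : c *: (p * p') = p * (c *: p').
Proof.
have pc : p * c%:MP = c%:MP * p.
  rewrite [LHS]fgmulgU [RHS]fgmulUg; apply: eq_bigr => k _.
  by rewrite mulm1 mul1m mulrC.
by rewrite -!mul_malgC !mulrA pc.
Qed.

Lemma Aq_scaleAr c (a b : Aq) : c *: (a * b) = a * (c *: b).
Proof.
elim/Aq_ind: a => p; elim/Aq_ind: b => p'.
transitivity (to_Aq (c *: (p * p'))); first by rewrite to_AqZ to_AqM.
by rewrite free_scaleAr to_AqM to_AqZ.
Qed.
HB.instance Definition _ := GRing.Lalgebra_isAlgebra.Build K Aq Aq_scaleAr.

Definition coordinate (g : gen) : Aq := to_Aq (free_gen g).

End SuperplaneAlgebra.

Record bimodule (K : fieldType) (A : algType K) := Bimodule {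
  bimodule_sort :> lmodType K;
  lact : A -> bimodule_sort -> bimodule_sort;
  ract : bimodule_sort -> A -> bimodule_sort;
  lact_linear : forall a, linear (lact a);
  lact_linearl : forall w, linear (lact^~ w);
  lact1 : forall w, lact 1 w = w;
  lactM : forall a b w, lact (a * b) w = lact a (lact b w);
  ract_linear : forall a, linear (ract^~ a);
  ract_linearr : forall w, linear (ract w);
  ract1 : forall w, ract w 1 = w;
  ractM : forall w a b, ract w (a * b) = ract (ract w a) b;
  lract : forall a w b, ract (lact a w) b = lact a (ract w b)
}.

(* A first-order differential calculus over an algebra A with distinguished
   elements x, xi, theta, z, obeying the commutation rules between these
   elements and their differentials.  One-forms have their coefficients on the
   right: the differentials of x, xi, theta, z form a basis of the right
   A-module of one-forms.  The Leibniz rule carries no sign, although A is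
   graded. *)
Record calculus (K : fieldType) (q : K) (A : algType K) (x xi theta z : A) :=
    Calculus {
  oneforms : bimodule A;
  d : {linear A -> oneforms};
  d_leibniz : forall f g, d (f * g) = ract (d f) g + lact f (d g);
  d_span : forall w : oneforms, exists a b c e,
    w = ract (d x) a + ract (d xi) b + ract (d theta) c + ract (d z) e;
  d_free : forall a b c e,
    ract (d x) a + ract (d xi) b + ract (d theta) c + ract (d z) e = 0 ->
    [/\ a = 0, b = 0, c = 0 & e = 0];
  x_dx : lact x (d x) = ract (d x) x;
  x_dxi : lact x (d xi) = q *: ract (d xi) x;
  x_dtheta : lact x (d theta) = q *: ract (d theta) x;
  x_dz : lact x (d z) = ract (d z) x;
  xi_dx : lact xi (d x) = q^-1 *: ract (d x) xi;
  xi_dxi : lact xi (d xi) = - ract (d xi) xi;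
  xi_dtheta : lact xi (d theta) = ract (d theta) xi;
  xi_dz : lact xi (d z) = (- q^-1) *: ract (d z) xi;
  theta_dx : lact theta (d x) = q^-1 *: ract (d x) theta;
  theta_dxi : lact theta (d xi) = ract (d xi) theta;
  theta_dtheta : lact theta (d theta) = - ract (d theta) theta;
  theta_dz : lact theta (d z) = (- q^-1) *: ract (d z) theta;
  z_dx : lact z (d x) = ract (d x) z;
  z_dxi : lact z (d xi) = (- q) *: ract (d xi) z;
  z_dtheta : lact z (d theta) = (- q) *: ract (d theta) z;
  z_dz : lact z (d z) = ract (d z) z
}.

Definition partial_derivatives (K : fieldType) (q : K) (A : algType K)
    (x xi theta z : A) (Gamma : calculus q x xi theta z)
    (Dx Dxi Dtheta Dz : A -> A) : Prop :=
  forall f, d Gamma f = ract (d Gamma x) (Dx f) + ract (d Gamma xi) (Dxi f)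
    + ract (d Gamma theta) (Dtheta f) + ract (d Gamma z) (Dz f).

Definition superplane_calculus (K : fieldType) (q : K) : Type :=
  calculus q (coordinate q gx) (coordinate q gxi) (coordinate q gtheta)
    (coordinate q gz).

(* Main.v *)
Require Import Defs.
From HB Require Import structures.
From mathcomp Require Import all_boot all_algebra.
From mathcomp Require Import reals complex.
From mathcomp.multinomials Require Import monalg.
Import GRing.Theory.
Local Open Scope ring_scope.

(** Applying [d] to a product [g f], with [g] a coordinate, and comparing
    coefficients in the basis of one-forms gives the relations
    [D_h (g f) = delta_gh f + c_gh g (D_h f)], where [g dh = c_gh dh g].  The
    discrepancy [E = D_h D_k - c_hk D_k D_h] then satisfies
    [E (g f) = c_gh c_gk g (E f)] as soon as [c_hk c_kh = 1], and it kills [1];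
    since the coordinates generate the algebra, [E = 0].  Likewise
    [D_h D_h = 0] when [c_hh = -1]. *)

(** Words span the free algebra, which maps onto [Aq q], and a word arises from the empty one by
    multiplying by letters on the left. *)
Lemma Aq_coordinate_ind (K : fieldType) (q : K) (P : Aq q -> Prop) :
  P 1 -> (forall c f f', P f -> P f' -> P (c *: f + f')) ->
  (forall g f, P f -> P (coordinate q g * f)) -> forall f, P f.
Proof.
(* Zero is reached as [(-1) *: 1 + 1]. *)
move=> P1 PL PM; have P0 : P 0.
  by rewrite -(addNr (1 : Aq q)) -(scaleN1r (1 : Aq q)); apply: PL.
have Pword (m : {fmonom gen}) : P (to_Aq q (mkmalgU m 1)).
  case: m => s; elim: s => [|g s IH].
    by rewrite (_ : FMonom [::] = mone) //; apply/eqP; rewrite fmP fm1.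
  have -> : FMonom (g :: s) = mmul (fmu g) (FMonom s).
    by apply/eqP; rewrite fmP fmM fmuE.
  rewrite -[X in mkmalgU _ X](mulr1 1) -fgmulUU -malgM_def to_AqM.
  exact: PM.
have Pmono c m : P (to_Aq q (mkmalgU m c)).
  have -> : mkmalgU m c = c *: mkmalgU m 1.
    by rewrite -mul_malgC malgM_def fgmulUU mul1m mulr1.
  rewrite (to_AqZ q c (mkmalgU m 1)) -[Aq_scale c _]addr0.
  exact: PL _ _ _ (Pword m) P0.
elim/Aq_ind=> p; rewrite (monalgE p).
elim: (X in \sum_(k <- X) _) => [|m r IH]; first by rewrite big_nil raddf0.
rewrite big_cons raddfD /= -[to_Aq _ (mkmalgU _ _)]scale1r.
exact: PL _ _ _ (Pmono _ m) IH.
Qed.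

HB.instance Definition _ (K : fieldType) (A : algType K) (W : bimodule A)
    (w : W) := GRing.isLinear.Build K A W *:%R (ract w) (ract_linearr w).
HB.instance Definition _ (K : fieldType) (A : algType K) (W : bimodule A)
    (a : A) := GRing.isLinear.Build K W W *:%R (lact a) (lact_linear a).

Lemma ractZl (K : fieldType) (A : algType K) (W : bimodule A) c (w : W) a :
  ract (c *: w) a = c *: ract w a.
Proof. exact: (GRing.scalable_linear (ract_linear a)). Qed.

Section PartialDerivatives.
Variables (K : fieldType) (q : K) (A : algType K) (coord : gen -> A).
Implicit Types (g h k : gen) (f : A).

(** Expresses that the coordinates generate [A] as an algebra. *)
Hypothesis coord_ind : forall P : A -> Prop,
  P 1 -> (forall c f f', P f -> P f' -> P (c *: f + f')) ->
  (forall g f, P f -> P (coord g * f)) -> forall f, P f.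

(* The scalar [c_gh] in the rule [g dh = c_gh dh g]. *)
Definition twist g h : K :=
  match g, h with
  | (false, false), (false, false) | (false, false), (true, true) => 1
  | (false, false), _ => q
  | (true, true), (false, false) | (true, true), (true, true) => 1
  | (true, true), _ => - q
  | _, (false, false) => q^-1
  | _, (true, true) => - q^-1
  | _, _ => if g == h then -1 else 1
  end.

Variable Gamma : calculus q (coord gx) (coord gxi) (coord gtheta) (coord gz).

Lemma lact_d_coordinate g h :
  lact (coord g) (d Gamma (coord h)) =
  twist g h *: ract (d Gamma (coord h)) (coord g).
Proof.
(* The cases list [true] before [false], hence run from z down to x. *)
case: g h => [[] []] [[] []]; rewrite ?scale1r ?scaleN1r.
- exact: (z_dz Gamma).
- exact: (z_dtheta Gamma).
- exact: (z_dxi Gamma).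
- exact: (z_dx Gamma).
- exact: (theta_dz Gamma).
- exact: (theta_dtheta Gamma).
- exact: (theta_dxi Gamma).
- exact: (theta_dx Gamma).
- exact: (xi_dz Gamma).
- exact: (xi_dtheta Gamma).
- exact: (xi_dxi Gamma).
- exact: (xi_dx Gamma).
- exact: (x_dz Gamma).
- exact: (x_dtheta Gamma).
- exact: (x_dxi Gamma).
- exact: (x_dx Gamma).
Qed.

(** Links sums over [gen] to the four-term shape of [d_free] and [partial_derivatives]. *)
Lemma sum_gen (V : zmodType) (F : gen -> V) :
  \sum_h F h = F gx + F gxi + F gtheta + F gz.
Proof.
transitivity (\sum_(h : bool * bool) F (h.1, h.2)).
  by apply: eq_bigr => -[].
rewrite -(pair_bigA _ (fun a b => F (a, b))) /= !big_bool /=.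
by rewrite addrC [F (false, true) + _]addrC [F (true, true) + _]addrC !addrA.
Qed.

Lemma partials_unique (a b : gen -> A) :
  \sum_h ract (d Gamma (coord h)) (a h) =
  \sum_h ract (d Gamma (coord h)) (b h) -> forall h, a h = b h.
Proof.
move=> eq_ab; suff ab0 h : a h - b h = 0 by move=> h; apply/subr0_eq/ab0.
have : \sum_h ract (d Gamma (coord h)) (a h - b h) = 0.
  under eq_bigr do rewrite raddfB.
  by rewrite sumrB eq_ab subrr.
by rewrite sum_gen => /d_free[? ? ? ?]; case: h => [[] []].
Qed.

Section Partials.
Variable D : gen -> {linear A -> A}.
Hypothesis DP : forall f, d Gamma f = \sum_h ract (d Gamma (coord h)) (D h f).

Lemma partial1 h : D h 1 = 0.
Proof.
(* The Leibniz rule on [1 * 1] reads d1 = d1 + d1. *)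
have d1 : d Gamma (1 : A) = 0.
  have := d_leibniz Gamma 1 1; rewrite mulr1 ract1 lact1.
  by move/esym/eqP; rewrite -subr_eq0 addrK => /eqP.
apply: (partials_unique (fun h => D h 1) (fun=> 0)); rewrite -DP d1.
by rewrite big1 // => k _; rewrite raddf0.
Qed.

Lemma partial_coordinateM g h f :
  D h (coord g * f) = (g == h)%:R *: f + twist g h *: (coord g * D h f).
Proof.
move: h; apply: partials_unique; rewrite -DP d_leibniz.
under [RHS]eq_bigr do rewrite raddfD.
rewrite big_split /=; congr (_ + _).
  (* The Leibniz term dg f accounts for the Kronecker delta. *)
  rewrite (bigD1 g) //= eqxx scale1r big1 ?addr0 // => h.
  by rewrite eq_sym => /negPf->; rewrite scale0r raddf0.
(* In the term g df, expand df and move g to the right past each dh, at the cost of [twist g h]. *)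
rewrite [d _ f]DP raddf_sum; apply: eq_bigr => h _ /=.
by rewrite -lract lact_d_coordinate ractZl -ractM linearZ.
Qed.

Lemma partials_commute h k : twist h k * twist k h = 1 ->
  forall f, D h (D k f) = twist h k *: D k (D h f).
Proof.
move=> hk; elim/coord_ind=> [|c f f' IH IH'|g f IH].
- by rewrite !partial1 !linear0.
- by rewrite !linearP /= IH IH'.
have DL l c u v : D l (c *: u + v) = c *: D l u + D l v by exact: linearP.
have DZ l c u : D l (c *: u) = c *: D l u by exact: linearZ.
(* Both sides become combinations of [D k f], [D h f] and [coord g * D k (D h f)]. The first occurs
   only for g = h, where the coefficients agree; the second only for g = k, where they agree by
   [hk]. *)
rewrite !partial_coordinateM !DL !DZ !partial_coordinateM IH.
rewrite -!scalerAr !scalerDr !scalerA addrCA; congr (_ + (_ + _)).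
- by case: eqVneq => [->|]; rewrite ?mulr0.
- by case: eqVneq => [->|]; rewrite ?mulr0 // mulr1 hk.
- by congr (_ *: _); rewrite [RHS]mulrAC [LHS]mulrC mulrA.
Qed.

Lemma partial_sqr0 h : twist h h = -1 -> forall f, D h (D h f) = 0.
Proof.
move=> hh; elim/coord_ind=> [|c f f' IH IH'|g f IH].
- by rewrite !partial1 !linear0.
- by rewrite !linearP /= IH IH' scaler0 addr0.
rewrite !partial_coordinateM linearP /= [D h (twist _ _ *: _)]linearZ /=.
rewrite !partial_coordinateM IH.
rewrite mulr0 scaler0 addr0 scalerA.
(* What remains is delta_gh (1 + [twist g h]) [D h f], and the bracket vanishes at g = h. *)
case: eqVneq => [->|_]; first by rewrite hh mulr1 scale1r scaleN1r subrr.
by rewrite mulr0 !scale0r addr0.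
Qed.

End Partials.
End PartialDerivatives.

Theorem proposition4 (R : realType) (q : R[i]) (q_neq0 : q != 0)
  (q_not_root_of_unity : forall n : nat, (0 < n)%N -> q ^+ n != 1)
  (Gamma : superplane_calculus q)
  (Dx Dxi Dtheta Dz : {linear Aq q -> Aq q})
  (partialsP : partial_derivatives Gamma Dx Dxi Dtheta Dz) :
  (forall f, Dx (Dxi f) = q *: Dxi (Dx f)) /\
  (forall f, Dx (Dtheta f) = q *: Dtheta (Dx f)) /\
  (forall f, Dx (Dz f) = Dz (Dx f)) /\
  (forall f, Dxi (Dtheta f) = Dtheta (Dxi f)) /\
  (forall f, Dxi (Dz f) = (- q^-1) *: Dz (Dxi f)) /\
  (forall f, Dtheta (Dz f) = (- q^-1) *: Dz (Dtheta f)) /\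
  (forall f, Dxi (Dxi f) = 0) /\
  (forall f, Dtheta (Dtheta f) = 0).
Proof.
pose D (g : gen) := match g with
  | (false, false) => Dx | (false, true) => Dxi
  | (true, false) => Dtheta | (true, true) => Dz end.
have DP f : d Gamma f = \sum_h ract (d Gamma (coordinate q h)) (D h f).
  by rewrite sum_gen; apply: partialsP.
have comm h k := partials_commute _ q _ _ (Aq_coordinate_ind _ q) Gamma D DP h k.
have sqr0 h := partial_sqr0 _ q _ _ (Aq_coordinate_ind _ q) Gamma D DP h.
(* For x or z paired with xi or theta, the condition on twists is q q^-1 = 1 or (-q^-1)(-q) = 1,
   whence [q_neq0]; for the other two pairs both twists are 1. *)
split; first by apply: (comm gx gxi); rewrite /= mulfV.
split; first by apply: (comm gx gtheta); rewrite /= mulfV.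
split; first by move=> f; rewrite (comm gx gz) /= ?mulr1 ?scale1r.
split; first by move=> f; rewrite (comm gxi gtheta) /= ?mulr1 ?scale1r.
split; first by apply: (comm gxi gz); rewrite /= mulrNN mulVf.
split; first by apply: (comm gtheta gz); rewrite /= mulrNN mulVf.
by split; [apply: (sqr0 gxi) | apply: (sqr0 gtheta)].
Qed.
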